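(* Let $E$ be a field that has finite transcendence degree over its prime subfield. Then $E$ is defined by types (as a structure in the first-order language of rings); that is, every structure $F$ in the language of rings that is isotypic to $E$ is isomorphic to $E$.
   Context: Let $\mathcal L$ be a first-order language and $A$ an $\mathcal L$-structure. For a finite tuple $\bar a=(a_1,\ldots,a_k)$ of elements of $A$, the type $\mathrm{tp}_A(\bar a)$ is the set of all first-order $\mathcal L$-formulas (without parameters) in $k$ free variables that hold in $A$ at $\bar a$. Two $\mathcal L$-structures $A$ and $B$ are isotypic if for every finite tuple $\bar a=(a_1,\ldots,a_k)$ over $A$ there is a tuple $\bar b=(b_1,\ldots,b_k)$ over $B$ of the same length with $\mathrm{tp}_A(\bar a)=\mathrm{tp}_B(\bar b)$, and vice versa (for every finite tuple over $B$ there is a tuple over $A$ of the same length with the same type). A structure $A$ is defined by types if every structure $B$ (in the same language) isotypic to $A$ is isomorphic to $A$. *)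

(* Defs.v *)
From HB Require Import structures.
From mathcomp Require Import all_boot all_order all_algebra.
From mathcomp Require Import mpoly.

Set Implicit Arguments.
Unset Strict Implicit.
Unset Printing Implicit Defensive.

Import GRing.Theory.
Local Open Scope ring_scope.

Record language : Type := Language {
  fsym : Type;
  farity : fsym -> nat;
  rsym : Type;
  rarity : rsym -> nat }.

Record structure (L : language) : Type := Structure {
  carrier :> Type;
  finterp : forall f : fsym L, ('I_(farity f) -> carrier) -> carrier;
  rinterp : forall r : rsym L, ('I_(rarity r) -> carrier) -> Prop }.

(* Terms and formulas are well scoped: [formula L k] is the type of formulas
   whose free variables are among [k] variables, indexed by ['I_k]. *)
Inductive term (L : language) (k : nat) : Type :=
| Var of 'I_k
| App (f : fsym L) of ('I_(farity f) -> term L k).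

Arguments Var {L k} _.
Arguments App {L k} f _.

(* A quantifier binds the variable [ord0] of its body; the other variables of
   the body are the [lift ord0 i]. *)
Inductive formula (L : language) : nat -> Type :=
| FEq k of term L k & term L k : formula L k
| FRel k (r : rsym L) of ('I_(rarity r) -> term L k) : formula L k
| FFalse k : formula L k
| FAnd k of formula L k & formula L k : formula L k
| FOr k of formula L k & formula L k : formula L k
| FImp k of formula L k & formula L k : formula L k
| FAll k of formula L k.+1 : formula L k
| FEx k of formula L k.+1 : formula L k.

Arguments FFalse {L k}.
Arguments FRel {L k} r _.

Definition scons (T : Type) (k : nat) (x : T) (a : 'I_k -> T) : 'I_k.+1 -> T :=
  fun i => if unlift ord0 i is Some j then a j else x.

Fixpoint eval (L : language) (A : structure L) (k : nat) (a : 'I_k -> A)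
    (t : term L k) : A :=
  match t with
  | Var i => a i
  | App f ts => finterp (fun j => eval a (ts j))
  end.

Fixpoint holds (L : language) (A : structure L) (k : nat) (phi : formula L k) :
    ('I_k -> A) -> Prop :=
  match phi in formula _ k return ('I_k -> A) -> Prop with
  | FEq _ s t => fun a => eval a s = eval a t
  | FRel _ r ts => fun a => rinterp (fun j => eval a (ts j))
  | FFalse _ => fun _ => False
  | FAnd _ p q => fun a => holds p a /\ holds q a
  | FOr _ p q => fun a => holds p a \/ holds q a
  | FImp _ p q => fun a => holds p a -> holds q a
  | FAll _ p => fun a => forall x : A, holds p (scons x a)
  | FEx _ p => fun a => exists x : A, holds p (scons x a)
  end.

Definition tp (L : language) (A : structure L) (k : nat) (a : 'I_k -> A) :
    formula L k -> Prop :=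
  fun phi => holds phi a.

Definition eq_type (L : language) (k : nat) (p q : formula L k -> Prop) : Prop :=
  forall phi, p phi <-> q phi.

Definition isotypic (L : language) (A B : structure L) : Prop :=
  (forall (k : nat) (a : 'I_k -> A), exists b : 'I_k -> B, eq_type (tp a) (tp b))
  /\
  (forall (k : nat) (b : 'I_k -> B), exists a : 'I_k -> A, eq_type (tp b) (tp a)).

Definition isomorphism (L : language) (A B : structure L) (h : A -> B) : Prop :=
  [/\ bijective h,
      forall (f : fsym L) (a : 'I_(farity f) -> A),
        h (finterp a) = finterp (fun i => h (a i))
    & forall (r : rsym L) (a : 'I_(rarity r) -> A),
        rinterp a <-> rinterp (fun i => h (a i))].

Definition isomorphic (L : language) (A B : structure L) : Prop :=
  exists h : A -> B, isomorphism h.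

Definition defined_by_types (L : language) (A : structure L) : Prop :=
  forall B : structure L, isotypic A B -> isomorphic A B.

Inductive ring_symbol : Type := RZero | ROne | RAdd | ROpp | RMul.

Definition ring_arity (f : ring_symbol) : nat :=
  match f with RZero | ROne => 0 | ROpp => 1 | RAdd | RMul => 2 end.

Definition ring_language : language :=
  @Language ring_symbol ring_arity void (fun r => match r with end).

Definition ring_finterp (R : nzRingType) (f : ring_symbol) :
    ('I_(ring_arity f) -> R) -> R :=
  match f return ('I_(ring_arity f) -> R) -> R with
  | RZero => fun _ => 0
  | ROne => fun _ => 1
  | RAdd => fun a => a ord0 + a ord_max
  | ROpp => fun a => - a ord0
  | RMul => fun a => a ord0 * a ord_max
  end.

Definition ring_structure (R : nzRingType) : structure ring_language :=
  @Structure ring_language R (@ring_finterp R) (fun r => match r with end).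

Section TranscendenceDegree.
Variable E : fieldType.
Implicit Types (K S : E -> Prop).

Definition subfield K : Prop :=
  [/\ K 1,
      forall x y, K x -> K y -> K (x - y)
    & forall x y, K x -> K y -> y != 0 -> K (x / y)].

Definition subfield_gen S : E -> Prop :=
  fun x => forall K, subfield K -> (forall y, S y -> K y) -> K x.

Definition prime_subfield : E -> Prop := subfield_gen (fun _ => False).

Definition adjoin K (n : nat) (a : 'I_n -> E) : E -> Prop :=
  subfield_gen (fun x => K x \/ exists i, x = a i).

Definition algebraic_over K (x : E) : Prop :=
  exists p : {poly E}, [/\ p != 0, forall i, K p`_i & root p x].

Definition algebraically_independent K (n : nat) (a : 'I_n -> E) : Prop :=
  forall p : {mpoly E[n]}, (forall m, K p@_m) -> p.@[a] = 0 -> p = 0.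

Definition transcendence_basis K (n : nat) (a : 'I_n -> E) : Prop :=
  algebraically_independent K a /\ forall x, algebraic_over (adjoin K a) x.

Definition transcendence_degree K (n : nat) : Prop :=
  exists a : 'I_n -> E, transcendence_basis K a.

Definition finite_transcendence_degree K : Prop :=
  exists n : nat, transcendence_degree K n.

End TranscendenceDegree.

(* Main.v *)
Require Import Defs.
From HB Require Import structures.
From mathcomp Require Import all_boot all_order all_algebra.
From mathcomp Require Import boolp classical_sets.
From Stdlib Require List.

Set Implicit Arguments.
Unset Strict Implicit.
Unset Printing Implicit Defensive.

Import GRing.Theory.

(** Write K(a) for the subfield generated by a tuple a.  Choose a tuple a in E
    of least length such that E is algebraic over K(a); one exists because E
    has finite transcendence degree.  As F is isotypic to E, it contains a tuple
    b of the type of a.  Every element of E is algebraic over a in the sense of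
    model theory: it satisfies a formula phi(x, a) with finitely many solutions
    (lemma [algebraic_over_tuple_of_acl]), namely that x is a root of a given
    nonzero polynomial with coefficients in the ring generated by a.

    The same is true of F over b.  For y in F, isotypy provides (e, a') in E
    with the type of (y, b), so a' has the type of a.  Were some entry of a'
    algebraic over the others, the same would hold in a, as this is witnessed
    by a formula, and a would not be of least length.  Hence a' is independent,
    and by Steinitz exchange E is algebraic over K(a')
    ([spans_of_type_minimal]).  So e satisfies a formula phi(x, a') with at most
    N solutions; having at most N solutions is a first-order property, and it
    passes to y and b.

    It remains to see that two structures that are algebraic over tuples of the
    same type are isomorphic ([isomorphic_of_algebraic]).  By Zorn's lemma, take
    a maximal partial elementary map from A to B extending a |-> b.  If e
    satisfies a formula over the domain with finitely many solutions, one with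
    the least number of solutions implies every other formula over the domain
    that e satisfies ([isolating_of_algebraic]).  A solution of the
    corresponding formula on the other side is then a possible image of e, so a
    maximal map is defined at e.  The same applied to the inverse map gives
    surjectivity. *)

(** * Tuples *)

Section Tuples.
Variable T : Type.

Lemma scons0 k (x : T) (a : 'I_k -> T) : scons x a ord0 = x.
Proof. by rewrite /scons unlift_none. Qed.

Lemma sconsS k (x : T) (a : 'I_k -> T) i : scons x a (lift ord0 i) = a i.
Proof. by rewrite /scons liftK. Qed.

Lemma scons_all k (P : T -> Prop) (x : T) (a : 'I_k -> T) :
  P x -> (forall i, P (a i)) -> forall i, P (scons x a i).
Proof. by move=> Px Pa i; rewrite /scons; case: unlift. Qed.

Lemma scons_comp (S : Type) (f : T -> S) k (x : T) (a : 'I_k -> T) :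
  (fun i => f (scons x a i)) = scons (f x) (fun i => f (a i)).
Proof.
by apply/funext=> i; rewrite /scons; case: unlift.
Qed.

(** Separates the occurrences of a new entry [e] in a tuple [q] from the entries
    in [G], so that what is said of [q] becomes a statement about [e] with
    parameters in [G]. *)
Lemma factor_through_scons (G : T -> Prop) (e : T) k (q : 'I_k -> T) :
    (forall i, G (q i) \/ q i = e) ->
  exists m (r : 'I_m -> T) (rho : 'I_k -> 'I_m.+1),
    (forall j, G (r j)) /\ q = fun i => scons e r (rho i).
Proof.
(* [r] needs entries in [G] even at the indices [rho] avoids: [t] fills them *)
move=> Gq; have [[t Gt]|noG] := pselect (exists t, G t).
  exists k, (fun i => if pselect (G (q i)) then q i else t).
  exists (fun i => if pselect (G (q i)) then lift ord0 i else ord0).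
  split=> [j|]; first by case: pselect.
  apply/funext=> i; case: (pselect (G (q i))) => Gi.
    by rewrite sconsS; case: pselect.
  by rewrite scons0; case: (Gq i).
exists 0%N, (fun i : 'I_0 => e), (fun=> ord0).
split=> [[]//|]; apply/funext=> i; rewrite scons0.
by case: (Gq i) => // Gi; case: noG; exists (q i).
Qed.

Definition concat k m (p : 'I_k -> T) (q : 'I_m -> T) : 'I_(k + m) -> T :=
  fun i => match split i with inl j => p j | inr j => q j end.

Lemma concat_lshift k m (p : 'I_k -> T) (q : 'I_m -> T) i :
  concat p q (lshift m i) = p i.
Proof. by rewrite /concat (unsplitK (inl i)). Qed.

Lemma concat_rshift k m (p : 'I_k -> T) (q : 'I_m -> T) i :
  concat p q (rshift k i) = q i.
Proof. by rewrite /concat (unsplitK (inr i)). Qed.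

Lemma concat_all (G : T -> Prop) k m (p : 'I_k -> T) (q : 'I_m -> T) :
  (forall i, G (p i)) -> (forall i, G (q i)) -> forall i, G (concat p q i).
Proof. by move=> Gp Gq i; rewrite /concat; case: split. Qed.

End Tuples.

(** * Renaming of variables, bounded counting *)

Section Renaming.
Variable L : language.

Fixpoint rename_term k m (r : 'I_k -> 'I_m) (t : term L k) : term L m :=
  match t with
  | Var i => Var (r i)
  | App f ts => App f (fun j => rename_term r (ts j))
  end.

Definition rename_under k m (r : 'I_k -> 'I_m) : 'I_k.+1 -> 'I_m.+1 :=
  scons ord0 (fun i => lift ord0 (r i)).

Fixpoint rename k (phi : formula L k) : forall m, ('I_k -> 'I_m) -> formula L m :=
  match phi in formula _ k return forall m, ('I_k -> 'I_m) -> formula L m with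
  | FEq _ s t => fun m r => FEq (rename_term r s) (rename_term r t)
  | FRel _ R ts => fun m r => FRel R (fun j => rename_term r (ts j))
  | FFalse _ => fun m r => FFalse
  | FAnd _ p q => fun m r => FAnd (rename p r) (rename q r)
  | FOr _ p q => fun m r => FOr (rename p r) (rename q r)
  | FImp _ p q => fun m r => FImp (rename p r) (rename q r)
  | FAll _ p => fun m r => FAll (rename p (rename_under r))
  | FEx _ p => fun m r => FEx (rename p (rename_under r))
  end.

Variable A : structure L.

Lemma eval_rename k m (r : 'I_k -> 'I_m) (a : 'I_m -> A) (t : term L k) :
  eval a (rename_term r t) = eval (fun i => a (r i)) t.
Proof. by elim: t => //= f ts IH; congr finterp; apply/funext=> j. Qed.

Lemma scons_rename_under k m (r : 'I_k -> 'I_m) (x : A) (a : 'I_m -> A) :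
  (fun i => scons x a (rename_under r i)) = scons x (fun i => a (r i)).
Proof.
rewrite scons_comp scons0; congr scons.
by apply/funext=> i; rewrite sconsS.
Qed.

Lemma holds_rename k (phi : formula L k) m (r : 'I_k -> 'I_m) (a : 'I_m -> A) :
  holds (rename phi r) a <-> holds phi (fun i => a (r i)).
Proof.
elim: phi m r a => {k} /=.
- by move=> k s t m r a; rewrite !eval_rename.
- move=> k R ts m r a.
  by under eq_fun do rewrite eval_rename.
- by [].
- by move=> k p IHp q IHq m r a; rewrite IHp IHq.
- by move=> k p IHp q IHq m r a; rewrite IHp IHq.
- by move=> k p IHp q IHq m r a; rewrite IHp IHq.
- move=> k p IHp m r a; split=> H x; have := H x;
    by rewrite IHp scons_rename_under.
- move=> k p IHp m r a; split=> -[x H]; exists x; move: H;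
    by rewrite IHp scons_rename_under.
Qed.

Definition FNot k (phi : formula L k) : formula L k := FImp phi FFalse.

(** By recursion on [n]: for some y, at most [n - 1] solutions differ from y.
    In the body, variable 0 is the solution and variable 1 is y. *)
Fixpoint at_most n k (phi : formula L k.+1) : formula L k :=
  if n is n'.+1 then
    FEx (at_most n'
      (FAnd (rename phi (scons ord0 (fun i => lift ord0 (lift ord0 i))))
            (FNot (FEq (Var ord0) (Var (lift ord0 ord0))))))
  else FAll (FNot phi).

(** The list may have repetitions and entries that are not solutions, hence a
    size exactly [n] expresses at most [n] solutions. *)
Lemma holds_at_most n k (phi : formula L k.+1) (a : 'I_k -> A) :
  holds (at_most n phi) a <->
  exists2 s : seq A, size s = n &
    forall x, holds phi (scons x a) -> List.In x s.
Proof.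
elim: n k phi a => [|n IH] k phi a /=.
  split=> [H|[s /size0nil -> //]].
  by exists [::].
have E x y : (fun i => scons x (scons y a)
   (scons ord0 (fun i : 'I_k => lift ord0 (lift ord0 i)) i)) = scons x a.
  rewrite scons_comp scons0; congr scons.
  by apply/funext=> i; rewrite !sconsS.
split=> [[y /IH[s ss H]]|[[//|y s] [ss] H]].
  exists (y :: s) => /=; first by rewrite ss.
  move=> x px; have [->|xy] := pselect (y = x); first by left.
  right; apply: H; split; last by rewrite /= sconsS !scons0 => /esym.
  by apply/holds_rename; rewrite E.
exists y; apply/IH; exists s => // x /= [/holds_rename].
rewrite E sconsS !scons0 => px xy.
by have [/esym|] := H x px.
Qed.

End Renaming.

(** * Partial elementary maps *)

Section BackAndForth.
Variable L : language.

(** [G] is the graph of a partial elementary map; that it is functional and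
    injective follows, since equality is a formula. *)
Definition elementary (A B : structure L) (G : A * B -> Prop) : Prop :=
  forall k (p : 'I_k -> A * B), (forall i, G (p i)) ->
    eq_type (tp (fun i => (p i).1)) (tp (fun i => (p i).2)).

Definition swap_rel (A B : structure L) (G : A * B -> Prop) : B * A -> Prop :=
  fun z => G (z.2, z.1).

Lemma elementary_swap (A B : structure L) (G : A * B -> Prop) :
  elementary G -> elementary (swap_rel G).
Proof.
move=> eG k p Gp phi.
by have [? ?] := eG k (fun i => ((p i).2, (p i).1)) Gp phi.
Qed.

Section Extension.
Variables (A B : structure L) (G : A * B -> Prop).

(** How a set defined over the domain of [G] is transported to one defined over
    its range. *)
Definition codefinable (U : A -> Prop) (V : B -> Prop) : Prop :=
  exists k (p : 'I_k -> A * B) (phi : formula L k.+1),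
    [/\ forall i, G (p i),
        forall x, U x <-> holds phi (scons x (fun i => (p i).1))
      & forall y, V y <-> holds phi (scons y (fun i => (p i).2))].

Lemma codefinable_not U V : codefinable U V ->
  codefinable (fun x => ~ U x) (fun y => ~ V y).
Proof.
case=> k [p [phi [Gp HU HV]]]; exists k, p, (FNot phi).
by split=> // x /=; rewrite ?HU ?HV.
Qed.

Lemma codefinable_and U V U' V' : codefinable U V -> codefinable U' V' ->
  codefinable (fun x => U x /\ U' x) (fun y => V y /\ V' y).
Proof.
case=> k [p [phi [Gp HU HV]]] [m [q [psi [Gq HU' HV']]]].
exists (k + m)%N, (concat p q).
exists (FAnd (rename phi (rename_under (lshift m)))
             (rename psi (rename_under (@rshift k m)))).
have El C (f : A * B -> C) :
    (fun i => f (concat p q (lshift m i))) = (fun i => f (p i)).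
  by apply/funext=> i; rewrite concat_lshift.
have Er C (f : A * B -> C) :
    (fun i => f (concat p q (rshift k i))) = (fun i => f (q i)).
  by apply/funext=> i; rewrite concat_rshift.
split=> [|x|y]; first exact: concat_all.
- by rewrite /= HU HU' !holds_rename !scons_rename_under (El _ fst) (Er _ fst).
- by rewrite /= HV HV' !holds_rename !scons_rename_under (El _ snd) (Er _ snd).
Qed.

Hypothesis eG : elementary G.

Lemma codefinable_ex U V : codefinable U V ->
  (exists x, U x) <-> (exists y, V y).
Proof.
case=> k [p [phi [Gp HU HV]]]; have E := eG Gp (FEx phi).
split=> [[x /HU Ux]|[y /HV Vy]].
  by have [|y Vy] := E.1; [exists x | exists y; apply/HV].
by have [|x Ux] := E.2; [exists y | exists x; apply/HU].
Qed.

Lemma codefinable_sub U V U' V' : codefinable U V -> codefinable U' V' ->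
  (forall x, U x -> U' x) -> forall y, V y -> V' y.
Proof.
move=> UV /codefinable_not UV' UU' y Vy; apply: contrapT => nV'y.
have [_ []] := codefinable_ex (codefinable_and UV UV'); first by exists y.
by move=> x [/UU'].
Qed.

Definition algebraic_element (e : A) : Prop :=
  exists U V, [/\ codefinable U V, U e
    & exists s : seq A, forall x, U x -> List.In x s].

(** Among the formulas with finitely many solutions satisfied by [e], one with
    the fewest solutions isolates the type of [e] over the domain of [G]: if it
    had a solution outside some [U'] containing [e], its conjunction with [U']
    would have fewer. *)
Lemma isolating_of_algebraic e : algebraic_element e ->
  exists U V, [/\ codefinable U V, U e
    & forall U' V', codefinable U' V' -> U' e -> forall x, U x -> U' x].
Proof.
case=> U [V [UV Ue [s Us]]].
have [n] := ubnP (size s); elim: n => // n IH in U V UV Ue s Us *.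
rewrite ltnS => sn; have [iso|] := pselect (forall U' V', codefinable U' V' ->
  U' e -> forall x, U x -> U' x); first by exists U, V.
move=> /existsNP[U' /existsNP[V' /not_implyP[UV' /not_implyP[U'e]]]].
move=> /existsNP[x /not_implyP[Ux nU'x]].
have [s1 [s2 ss]] := List.in_split _ _ (Us _ Ux).
apply: (IH _ _ (codefinable_and UV UV') _ (s1 ++ s2)) => //.
  move=> z [/Us + U'z]; rewrite ss => /(@List.in_app_or A) zs.
  apply: (@List.in_or_app A); case: zs => [|[xz|]]; [by left | | by right].
  by case: nU'x; rewrite xz.
apply: leq_trans sn; rewrite ss -[(_ ++ _)%list]/(s1 ++ x :: s2).
by rewrite !size_cat /= addnS.
Qed.

(** Any solution [e'] of the formula corresponding to an isolating one has over
    the range of [G] the type that [e] has over the domain. *)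
Lemma elementary_extend e : algebraic_element e ->
  exists e', elementary (fun z => G z \/ z = (e, e')).
Proof.
case/isolating_of_algebraic=> [U [V [UV Ue iso]]].
have [|e' Ve'] := (codefinable_ex UV).1; first by exists e.
have sub U' V' : codefinable U' V' -> U' e -> V' e'.
  by move=> UV' U'e; apply: (codefinable_sub UV UV' (iso _ _ UV' U'e)).
exists e' => k q Gq phi; have [m [r [rho [Gr ->]]]] := factor_through_scons Gq.
have qE (C : structure L) (f : A * B -> C) :
    (fun i => f (scons (e, e') r (rho i))) =
    (fun i => scons (f (e, e')) (fun i => f (r i)) (rho i)).
  by apply/funext=> i; rewrite -(scons_comp f).
rewrite /tp !qE /=.
(* the formula [phi] as a condition on the entry [e] alone *)
pose W (C : structure L) (c : 'I_m -> C) x := holds (rename phi rho) (scons x c).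
have UV' : codefinable (W A (fun i => (r i).1)) (W B (fun i => (r i).2)).
  by exists m, r, (rename phi rho).
split=> h; first by apply/holds_rename/(sub _ _ UV'); apply/holds_rename.
apply: contrapT => nh.
apply: (sub _ _ (codefinable_not UV')); last by apply/holds_rename.
by move=> /holds_rename.
Qed.

End Extension.

(** Algebraicity in the sense of model theory. *)
Definition algebraic_over_tuple (A : structure L) n (a : 'I_n -> A) (e : A) :=
  exists phi : formula L n.+1, holds phi (scons e a) /\
    exists s : seq A, forall x, holds phi (scons x a) -> List.In x s.

Lemma elementary_extend_tuple (A B : structure L) (G : A * B -> Prop) n
    (a : 'I_n -> A) (b : 'I_n -> B) e :
  elementary G -> (forall i, G (a i, b i)) -> algebraic_over_tuple a e ->
  exists e', elementary (fun z => G z \/ z = (e, e')).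
Proof.
move=> eG Gab [phi [pe [s ps]]]; apply: elementary_extend => //.
exists (fun x => holds phi (scons x a)), (fun y => holds phi (scons y b)).
split=> //; last by exists s.
by exists n, (fun i => (a i, b i)), phi.
Qed.

(** * Structures algebraic over tuples of the same type *)

Section Isomorphism.
Variables (A B : structure L) (n : nat) (a : 'I_n -> A) (b : 'I_n -> B).

Definition tuple_graph : set (A * B) := fun z => exists i, z = (a i, b i).

Lemma elementary_tuple_graph : eq_type (tp a) (tp b) -> elementary tuple_graph.
Proof.
move=> ab k p /choice[rho pE] phi.
have -> : p = fun i => (a (rho i), b (rho i)) by apply/funext.
by have := ab (rename phi rho); rewrite /tp !holds_rename.
Qed.

Lemma chain_bound (F : set (set (A * B))) X0 k (p : 'I_k -> A * B) :
    total_on F subset -> F X0 ->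
    (forall i, (\bigcup_(X in F) X `|` tuple_graph)%classic (p i)) ->
  exists2 X, F X & forall i, (X `|` tuple_graph)%classic (p i).
Proof.
move=> totF FX0 Fp.
have [X FX Xp] : exists2 X, F X &
    forall i, i \in enum 'I_k -> (X `|` tuple_graph)%classic (p i).
  elim: (enum 'I_k) => [|j l [X FX Xl]]; first by exists X0.
  have [[Y FY Yj]|bj] := Fp j; last first.
    by exists X => // i; rewrite inE => /predU1P[->|/Xl//]; right.
  have [XY|YX] := totF _ _ FX FY.
    exists Y => // i; rewrite inE => /predU1P[->|/Xl[/XY|]]; by [left | right].
  by exists X => // i; rewrite inE => /predU1P[->|/Xl//]; left; apply: YX.
by exists X => // i; apply: Xp; rewrite mem_enum.
Qed.

(** Zorn's lemma is applied to the [X] whose union with [tuple_graph] is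
    elementary, rather than to the elementary extensions of [tuple_graph], so
    that the empty chain also has a bound. *)
Lemma maximal_elementary : eq_type (tp a) (tp b) ->
  exists G : set (A * B), [/\ elementary G, forall i, G (a i, b i)
    & forall z, elementary (fun w => G w \/ w = z) -> G z].
Proof.
move=> ab.
have [F FP totF|G [eG maxG]] :=
    @Zorn_bigcup _ (fun X => elementary (X `|` tuple_graph)%classic).
  have [[X0 FX0]|F0] := pselect (exists X, F X).
    move=> k p /(chain_bound totF FX0)[X FX Xp].
    exact: FP FX _ _ Xp.
  move=> k p Fp; apply: (elementary_tuple_graph ab) => i.
  by case: (Fp i) => // -[X FX]; case: F0; exists X.
exists (G `|` tuple_graph)%classic; split=> // [i|z ez]; first by right; exists i.
have [Gz|nGz] := pselect (G z); [by left | right].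
apply: contrapT => nbz; apply: (maxG (G `|` [set z])%classic).
  by split=> [|/(_ z)/= h]; [left | apply: nGz; apply: h; right].
move=> k p Gp; apply: ez => i.
by case: (Gp i) => [[]|]; [left; left|right|left; right].
Qed.

Lemma isomorphic_of_graph (G : A * B -> Prop) : elementary G ->
  (forall x, exists y, G (x, y)) -> (forall y, exists x, G (x, y)) ->
  isomorphic A B.
Proof.
move=> eG /choice[h Gh] /choice[g Gg].
have two (z w : A * B) : G z -> G w -> z.1 = w.1 <-> z.2 = w.2.
  move=> Gz Gw; pose p : 'I_2 -> A * B := scons z (fun=> w).
  have Gp i : G (p i) by exact: scons_all.
  have := eG _ p Gp (FEq (Var ord0) (Var (lift ord0 ord0))).
  by rewrite /tp /= /p !scons0 !sconsS.
exists h; split.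
- exists g => [x|y].
    by have [_ E] := two _ _ (Gg (h x)) (Gh x); apply: E.
  by have [E _] := two _ _ (Gh (g y)) (Gg y); apply: E.
- move=> f c.
  pose p := scons (finterp c, h (finterp c)) (fun i => (c i, h (c i))).
  have Gp i : G (p i) by exact: scons_all.
  have [+ _] := eG _ p Gp (FEq (Var ord0) (App f (fun j => Var (lift ord0 j)))).
  have pS C (u : A * B -> C) :
      (fun j => u (p (lift ord0 j))) = (fun j => u (c j, h (c j))).
    by apply/funext=> j; rewrite /p sconsS.
  rewrite /tp /= (pS _ fst) (pS _ snd) /p !scons0; exact.
- move=> r c.
  have := eG _ (fun i => (c i, h (c i))) (fun i => Gh _) (FRel r (fun j => Var j)).
  by [].
Qed.

End Isomorphism.

Theorem isomorphic_of_algebraic (A B : structure L) n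
    (a : 'I_n -> A) (b : 'I_n -> B) :
  eq_type (tp a) (tp b) ->
  (forall x, algebraic_over_tuple a x) -> (forall y, algebraic_over_tuple b y) ->
  isomorphic A B.
Proof.
move=> ab algA algB; have [G [eG Gab maxG]] := maximal_elementary ab.
apply: (isomorphic_of_graph eG) => [x|y].
  by have [y /maxG] := elementary_extend_tuple eG Gab (algA x); exists y.
have [x ex] := elementary_extend_tuple (G := swap_rel G)
  (elementary_swap eG) Gab (algB y).
exists x; apply: maxG => k p Gp; apply: (elementary_swap ex) => i.
by case: (Gp i) => [|->]; [left; rewrite /swap_rel /= -surjective_pairing | right].
Qed.

End BackAndForth.

Local Open Scope ring_scope.

(** * Algebraic closure inside a field *)

Section SubfieldType.
Variables (E : fieldType) (K : E -> Prop) (hK : subfield K).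

Lemma subfield0 : K 0.
Proof. by case: hK => K1 KB _; rewrite -(subrr 1); apply: (KB). Qed.

Lemma subfieldM x y : K x -> K y -> K (x * y).
Proof.
case: hK => K1 KB KV Kx Ky; have [->|y0] := eqVneq y 0.
  by rewrite mulr0; apply: subfield0.
by rewrite -[y]invrK; apply: (KV); rewrite ?invr_eq0 // -div1r; apply: KV.
Qed.

(** Carries the proof of [subfield K] as a phantom argument, so that the
    closure properties can be attached to it as canonical structures. *)
Definition subfield_pred (h : subfield K) : pred E := fun x => `[<K x>].

Lemma subfield_divring_closed : divring_closed (subfield_pred hK).
Proof.
case: (hK) => K1 KB KV.
split=> [|x y /asboolP Kx /asboolP Ky|x y /asboolP Kx /asboolP Ky];
  apply/asboolP; [by []|exact: KB|].
have [->|y0] := eqVneq y 0; last exact: KV.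
by rewrite invr0 mulr0; apply: subfield0.
Qed.

HB.instance Definition _ :=
  GRing.isDivringClosed.Build E (subfield_pred hK) subfield_divring_closed.

Record subfield_type := SubfieldType {
  subfield_val : E; _ : subfield_val \in subfield_pred hK }.

HB.instance Definition _ := [isSub for subfield_val].
HB.instance Definition _ := [Choice of subfield_type by <:].
HB.instance Definition _ := [SubChoice_isSubIntegralDomain of subfield_type by <:].
HB.instance Definition _ := [SubIntegralDomain_isSubField of subfield_type by <:].

Local Notation iota := (val : subfield_type -> E).

(** Gives access to the theory of integral elements, in which closure under the
    field operations and transitivity are known. *)
Lemma algebraic_overE x : algebraic_over K x <-> integralOver iota x.
Proof.
rewrite -(integral_algebraic (val : {rmorphism subfield_type -> E})).
split=> [[p [p0 Kp px]]|[p p0 px]]; last first.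
  exists (map_poly iota p); split=> // [|i]; first by rewrite map_poly_eq0.
  by rewrite coef_map; apply/asboolP/(valP p`_i).
pose p' : {poly subfield_type} := \poly_(i < size p) insubd 0 p`_i.
have pE : map_poly iota p' = p.
  apply/polyP=> i; rewrite coef_map coef_poly; case: ltnP => ip.
    by apply: insubdK; apply/asboolP.
  by rewrite nth_default.
exists p'; rewrite ?pE //.
by rewrite -(map_poly_eq0 (val : {rmorphism subfield_type -> E})) pE.
Qed.

End SubfieldType.

Section AlgebraicClosure.
Variable E : fieldType.
Implicit Types (K S T R : E -> Prop) (x y z : E) (s t u w : seq E).

Lemma algebraic_of_mem K x : subfield K -> K x -> algebraic_over K x.
Proof.
move=> hK Kx; exists ('X - x%:P); rewrite polyXsubC_eq0 root_XsubC eqxx.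
split=> // i; case: (hK) => K1 KB _.
rewrite coefB coefX coefC; apply: (KB); last by case: eqP => // _; exact: subfield0.
by case: eqP => // _; exact: subfield0.
Qed.

Lemma subfield_algebraic K : subfield K -> subfield (algebraic_over K).
Proof.
move=> hK; split=> [|x y|x y].
- by apply: algebraic_of_mem => //; case: hK.
- by rewrite !(algebraic_overE hK); apply: integral_sub.
- by rewrite !(algebraic_overE hK) => ax ay _; apply: integral_div.
Qed.

Lemma algebraic_over_trans K x : subfield K ->
  algebraic_over (algebraic_over K) x -> algebraic_over K x.
Proof.
move=> hK [p [p0 Kp px]]; rewrite (algebraic_overE hK).
apply: (integral_root p0 px); apply/integral_poly => i.
by rewrite -(algebraic_overE hK).
Qed.

Lemma algebraic_over_mono K K' x : (forall z, K z -> K' z) ->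
  algebraic_over K x -> algebraic_over K' x.
Proof. by move=> KK' [p [p0 Kp px]]; exists p; split=> // i; apply: KK'. Qed.

Lemma subfield_gen_subfield S : subfield (subfield_gen S).
Proof.
split=> [K [] //|x y Sx Sy K hK SK|x y Sx Sy y0 K hK SK]; case: (hK) => K1 KB KV.
  by apply: (KB); [apply: Sx | apply: Sy].
by apply: KV => //; [apply: Sx | apply: Sy].
Qed.

Lemma mem_subfield_gen S x : S x -> subfield_gen S x.
Proof. by move=> Sx K _; apply. Qed.

Definition acl S : E -> Prop := algebraic_over (subfield_gen S).

Lemma acl_mem S x : S x -> acl S x.
Proof.
move=> Sx; apply: algebraic_of_mem; last exact: mem_subfield_gen.
exact: subfield_gen_subfield.
Qed.

Lemma acl_sub S T x : (forall z, S z -> acl T z) -> acl S x -> acl T x.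
Proof.
move=> ST Sx; apply: algebraic_over_trans; first exact: subfield_gen_subfield.
apply: algebraic_over_mono Sx => z; apply; last exact: ST.
exact/subfield_algebraic/subfield_gen_subfield.
Qed.

Lemma acl_mono S T x : (forall z, S z -> T z) -> acl S x -> acl T x.
Proof. by move=> ST; apply: acl_sub => z /ST; apply: acl_mem. Qed.

Definition subring R : Prop :=
  [/\ R 1, forall x y, R x -> R y -> R (x - y)
    & forall x y, R x -> R y -> R (x * y)].

Lemma subring0 R : subring R -> R 0.
Proof. by case=> R1 RB _; rewrite -(subrr 1); apply: (RB). Qed.

Lemma subring_of_subfield K : subfield K -> subring K.
Proof. by move=> hK; case: (hK) => K1 KB _; split=> // x y; exact: subfieldM. Qed.

Definition fractions R x := exists u d : E, [/\ R u, R d, d != 0 & x = u / d].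

Lemma fractions_subfield R : subring R -> subfield (fractions R).
Proof.
move=> hR; case: (hR) => R1 RB RM; split.
- by exists 1, 1; rewrite oner_eq0 divr1.
- move=> _ _ [u [d [Ru Rd d0 ->]]] [v [e [Rv Re e0 ->]]].
  exists (u * e - v * d), (d * e); split; [by apply: (RB); apply: (RM)|exact: RM| |].
    by rewrite mulf_neq0.
  by rewrite -mulNr addf_div // mulNr.
- move=> _ _ [u [d [Ru Rd d0 ->]]] [v [e [Rv Re e0 ->]]].
  rewrite mulf_eq0 negb_or => /andP[v0 _].
  exists (u * e), (d * v); split; [exact: RM|exact: RM| |].
    by rewrite mulf_neq0.
  by rewrite invf_div mulf_div.
Qed.

Lemma common_denominator R n (c : nat -> E) : subring R ->
  (forall i, fractions R (c i)) ->
  exists d, [/\ R d, d != 0 & forall i, (i < n)%N -> R (d * c i)].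
Proof.
move=> hR Fc; case: (hR) => R1 RB RM; elim: n => [|n [d [Rd d0 Rdc]]].
  by exists 1; rewrite oner_eq0.
have [u [e [Ru Re e0 cE]]] := Fc n.
exists (d * e); split=> [||i]; [exact: RM|by rewrite mulf_neq0|].
rewrite ltnS leq_eqVlt => /predU1P[->|/Rdc Ri].
  by rewrite cE -mulrA [u / e]mulrC mulVKf //; apply: (RM).
by rewrite mulrAC; apply: (RM).
Qed.

(** Clearing denominators in the coefficients. *)
Lemma algebraic_over_subring R S x : subring R -> (forall z, S z -> R z) ->
  acl S x -> algebraic_over R x.
Proof.
move=> hR SR [p [p0 Sp px]].
have Fp i : fractions R p`_i.
  apply: Sp; first exact: fractions_subfield.
  move=> z /SR Rz; exists z, 1; case: (hR) => R1 _ _.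
  by rewrite oner_eq0 divr1.
have [d [Rd d0 Rdp]] := common_denominator (size p) hR Fp.
exists (d *: p); rewrite rootZ // scaler_eq0 negb_or d0; split=> // i.
rewrite coefZ; case: (ltnP i (size p)) => [/Rdp //|ip].
by rewrite nth_default // mulr0; apply: subring0.
Qed.

Lemma subring_horner R (p : {poly E}) x : subring R ->
  (forall i, R p`_i) -> R x -> R p.[x].
Proof.
move=> hR Rp Rx; case: (hR) => R1 RB RM.
have RD y z : R y -> R z -> R (y + z).
  move=> Ry Rz; rewrite -[z]opprK; apply: (RB) => //.
  by rewrite -sub0r; apply: (RB) => //; apply: subring0.
rewrite horner_coef; elim/big_ind: _ => [||i _]; [exact: subring0|exact: RD|].
apply: (RM) => //; elim: (val i) => // k IH.
by rewrite exprS; apply: (RM).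
Qed.

(** Clearing denominators, [x] is a root of [P(X, y)] for a nonzero bivariate
    polynomial [P] over the subfield generated by [S].  Then [y] is a root of
    [P(x, Y)], whose coefficients are polynomials in [x], not all zero because
    [x] is not algebraic over [S]. *)
Lemma acl_exchange S x y :
  acl (fun z => S z \/ z = y) x -> ~ acl S x -> acl (fun z => S z \/ z = x) y.
Proof.
set K := subfield_gen S => yx nx.
have hK : subfield K := subfield_gen_subfield S.
have rK := subring_of_subfield hK; case: (rK) => K1 KB KM.
pose R z := exists2 q : {poly E}, forall i, K q`_i & z = q.[y].
have hR : subring R.
  split=> [|_ _ [p Kp ->] [q Kq ->]|_ _ [p Kp ->] [q Kq ->]].
  - exists 1 => [i|]; rewrite ?hornerC // coef1.
    by case: eqP => //= _; apply: subring0.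
  - by exists (p - q) => [i|]; rewrite ?hornerD ?hornerN ?coefB //; apply: (KB).
  - exists (p * q) => [i|]; rewrite ?hornerM // coefM.
    elim/big_ind: _ => [|u v Ku Kv|j _]; [exact: subring0| |exact: KM].
    rewrite -[v]opprK; apply: (KB) => //.
    by rewrite -sub0r; apply: (KB) => //; apply: subring0.
have SR z : S z \/ z = y -> R z.
  case=> [Sz|->].
    exists z%:P => [i|]; rewrite ?hornerC // coefC.
    by case: eqP => // _; [apply: mem_subfield_gen|apply: subring0].
  exists 'X => [i|]; rewrite ?hornerX // coefX.
  by case: eqP => //= _; apply: subring0.
have [p [p0 /choice[q Kq] px]] : exists p : {poly E}, [/\ p != 0,
    forall i, exists q : {poly E}, (forall i, K q`_i) /\ p`_i = q.[y] & root p x].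
  have [p [p0 Rp px]] := algebraic_over_subring hR SR yx.
  by exists p; split=> // i; have [q] := Rp i; exists q.
pose P : {poly {poly E}} := \poly_(i < size p) q i.
have KP i j : K P`_i`_j.
  rewrite coef_poly; case: ltnP => _; first by have [] := Kq i.
  by rewrite coef0; apply: subring0.
have pE : map_poly (horner_eval y) P = p.
  apply/polyP=> i; rewrite coef_map coef_poly /=.
  case: ltnP => ip; first by have [_ ->] := Kq i.
  by rewrite rmorph0 nth_default.
have P0 : P != 0 by apply: contraNneq p0 => P0; rewrite -pE P0 rmorph0.
exists P.[x%:P]; split.
- apply/eqP=> Px0; case/eqP: P0; apply/eqP; rewrite -swapXY_eq0.
  apply/eqP/polyP=> j.
  rewrite coef0; apply: contrapT => /eqP nz; apply: nx.
  exists (swapXY P)`_j; split=> // [i|]; first by rewrite coef_swapXY; apply: KP.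
  by move/polyP: Px0 => /(_ j); rewrite horner_polyC coef_map coef0 => /eqP.
- move=> j; rewrite horner_polyC coef_map /=.
  apply: (@subring_horner (subfield_gen _)) => [|i|].
  + exact/subring_of_subfield/subfield_gen_subfield.
  + by rewrite coef_swapXY => L hL SL; apply: KP => // z Sz; apply: SL; left.
  + by apply: mem_subfield_gen; right.
- by rewrite /root -horner2_swapXY horner_swapXY pE.
Qed.

Definition spanning s := forall x, acl (fun z => z \in s) x.

(** Steinitz exchange: the entries of an independent sequence replace, one at a
    time, entries of a spanning sequence. *)
Lemma spanning_exchange u w :
    (forall l1 x l2, u = l1 ++ x :: l2 -> ~ acl (fun z => z \in l2) x) ->
    spanning w ->
  exists2 w', (size u + size w' = size w)%N & spanning (u ++ w').
Proof.
move=> indep sw; elim: u indep => [|x u IH] indep; first by exists w.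
have [l1 y l2 e|w' sz suw] := IH; first by apply: (indep (x :: l1)); rewrite e.
have nx : ~ acl (fun z => z \in u) x by apply: (indep [::]).
(* the first entry of [w'] on which [x] depends modulo [u] *)
have [l1 [y [l2 [w'E xy nxy]]]] : exists l1 y l2, [/\ w' = l1 ++ y :: l2,
    acl (fun z => z \in u ++ rcons l1 y) x & ~ acl (fun z => z \in u ++ l1) x].
  have : acl (fun z => z \in u ++ w') x by apply: suw.
  elim/last_ind: (w') => [|v y IHv]; first by rewrite cats0.
  move=> xvy.
  have [/IHv[l1 [z [l2 [-> ? ?]]]]|nxv] := pselect (acl (fun z => z \in u ++ v) x).
    by exists l1, z, (rcons l2 y); rewrite rcons_cat.
  by exists v, y, [::]; rewrite cats1.
have yx : acl (fun z => z \in u ++ l1 \/ z = x) y.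
  apply: acl_exchange nxy; apply: acl_mono xy => z.
  by rewrite -rcons_cat mem_rcons inE => /predU1P[->|]; [right | left].
exists (l1 ++ l2) => [|v].
  by rewrite -sz w'E !size_cat /= !addSn !addnS.
apply: acl_sub (suw v) => z; rewrite w'E mem_cat mem_cat inE => zin.
have [/eqP->|zy] := boolP (z == y).
  apply: acl_mono yx => t; rewrite !(mem_cat, inE).
  by move=> [/orP[]->|->]; rewrite ?eqxx ?orbT.
apply: acl_mem; move: zin; rewrite (negbTE zy) /= !(mem_cat, inE).
by move=> /or3P[]->; rewrite ?orbT.
Qed.

End AlgebraicClosure.

(** * Algebraic dependence as a formula *)

Section RingFormulas.
Variable E : fieldType.
Local Notation A := (ring_structure E).
Local Notation rterm := (term ring_language).

Section Terms.
Variable k : nat.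

Definition tzero : rterm k :=
  @App ring_language k RZero (fun i : 'I_0 => False_rect _ (notF (ltn_ord i))).
Definition tone : rterm k :=
  @App ring_language k ROne (fun i : 'I_0 => False_rect _ (notF (ltn_ord i))).
Definition tbin (c : ring_symbol) (t u : rterm k) : rterm k :=
  @App ring_language k c (fun i => if val i is 0 then t else u).
Definition tadd := tbin RAdd.
Definition tmul := tbin RMul.
Definition topp (t : rterm k) : rterm k := @App ring_language k ROpp (fun=> t).

Variable a : 'I_k -> E.
Local Notation ev := (eval (A := A) a).

Definition term_values (x : E) : Prop := exists t, x = ev t.

Lemma subring_term_values : subring term_values.
Proof.
split=> [|_ _ [t ->] [u ->]|_ _ [t ->] [u ->]].
- by exists tone.
- by exists (tadd t (topp u)).
- by exists (tmul t u).
Qed.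

Lemma subring_eval (R : E -> Prop) t :
  subring R -> (forall i, R (a i)) -> R (ev t).
Proof.
move=> hR Ra; case: (hR) => R1 RB RM.
have RN z : R z -> R (- z).
  by rewrite -sub0r; apply: RB; apply: subring0.
elim: t => [i|[] ts IH] /=; [exact: Ra|exact: subring0|exact: R1| | |].
- by rewrite -[X in _ + X]opprK; apply: (RB); [|apply: RN]; apply: IH.
- exact/RN/IH.
- by apply: RM; apply: IH.
Qed.

End Terms.

Definition poly_at k (a : 'I_k -> E) (ts : seq (rterm k)) : {poly E} :=
  Poly (map (eval (A := A) a) ts).

Definition weaken k (t : rterm k) : rterm k.+1 := rename_term (lift ord0) t.

Lemma eval_weaken k (a : 'I_k -> E) x t :
  eval (A := A) (scons x a) (weaken t) = eval (A := A) a t.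
Proof.
by rewrite eval_rename; congr eval; apply/funext=> i; rewrite sconsS.
Qed.

Definition nonzero_formula k (ts : seq (rterm k)) : formula ring_language k.+1 :=
  foldr (fun t phi => FOr (FNot (FEq (weaken t) (tzero k.+1))) phi) FFalse ts.

Definition horner_term k (ts : seq (rterm k)) : rterm k.+1 :=
  foldr (fun t u => tadd (tmul u (Var ord0)) (weaken t)) (tzero k.+1) ts.

Definition root_formula k (ts : seq (rterm k)) : formula ring_language k.+1 :=
  FAnd (nonzero_formula ts) (FEq (horner_term ts) (tzero k.+1)).

Lemma holds_root_formula k (a : 'I_k -> E) ts x :
  holds (A := A) (root_formula ts) (scons x a) <->
  poly_at a ts != 0 /\ root (poly_at a ts) x.
Proof.
rewrite /poly_at /=.
have -> : holds (A := A) (nonzero_formula ts) (scons x a) <->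
    Poly (map (eval (A := A) a) ts) != 0.
  elim: ts => /= [|t ts ->]; first by rewrite eqxx.
  rewrite -[cons_poly _ _ == 0]size_poly_eq0 size_cons_poly nil_poly eval_weaken.
  case: (eqVneq (Poly _) 0) => [->|p0] /=; last by split=> // _; right.
  case: (eqVneq (eval (A := A) a t : E) 0) => [->|/eqP t0] /=.
    by split=> // -[[]|].
  by split=> // _; left.
have -> : eval (A := A) (scons x a) (horner_term ts) =
    (Poly (map (eval (A := A) a) ts)).[x].
  rewrite horner_Poly; elim: ts => //= t ts IH.
  by rewrite IH eval_weaken scons0.
by split=> -[? /eqP].
Qed.

(** The values at [a] of ring terms form a subring containing [a], so after
    clearing denominators a polynomial over the field generated by [a] has
    coefficients given by terms. *)
Lemma aclP k (a : 'I_k -> E) x :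
  acl (fun z => exists i, z = a i) x <->
  exists ts, holds (A := A) (root_formula ts) (scons x a).
Proof.
split=> [ax|[ts /holds_root_formula[nz rx]]]; last first.
  exists (poly_at a ts); split=> // i.
  have sg := subring_of_subfield
    (subfield_gen_subfield (fun z => exists i, z = a i)).
  rewrite coef_Poly; have [ilt|ige] := ltnP i (size ts); last first.
    by rewrite nth_default ?size_map //; apply: subring0.
  rewrite (nth_map (tzero k)) //; apply: subring_eval => // j.
  by apply: mem_subfield_gen; exists j.
have [z [i ->]|p [p0 /choice[t pE] px]] :=
    algebraic_over_subring (subring_term_values a) _ ax.
  by exists (Var i).
exists (map t (iota 0 (size p))); apply/holds_root_formula.
have -> // : poly_at a (map t (iota 0 (size p))) = p.
rewrite /poly_at -map_comp (eq_map (g := fun i => p`_i)) => [|i]; last first.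
  by rewrite /= -pE.
by rewrite -[map _ _]/(mkseq _ _) mkseq_nth polyseqK.
Qed.

Lemma finite_roots (p : {poly E}) : p != 0 ->
  exists s : seq E, forall x, root p x -> List.In x s.
Proof.
have [n] := ubnP (size p); elim: n p => // n IH p pn p0.
have [[a pa]|np] := pselect (exists a, root p a); last first.
  by exists [::] => x px; case: np; exists x.
have /factor_theorem[q pE] := pa.
have q0 : q != 0 by apply: contraNneq p0 => q0; rewrite pE q0 mul0r.
have [|s qs] := IH q _ q0.
  by move: pn; rewrite pE size_Mmonic ?monicXsubC // size_XsubC addn2.
exists (a :: s) => x; rewrite pE rootM root_XsubC.
by case/orP=> [/qs|/eqP->]; [right | left].
Qed.

Lemma algebraic_over_tuple_of_acl k (a : 'I_k -> E) x :
  acl (fun z => exists i, z = a i) x -> algebraic_over_tuple (A := A) a x.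
Proof.
move=> /aclP[ts h]; exists (root_formula ts); split=> //.
have /holds_root_formula[/finite_roots[s ps] _] := h.
by exists s => y /holds_root_formula[_ /ps].
Qed.

Definition tuple_spans k (a : 'I_k -> E) : Prop :=
  forall x, acl (fun z => exists i, z = a i) x.

Lemma dependence_of_type k m (a a' : 'I_k -> E) (c : 'I_m -> 'I_k) i :
  eq_type (tp (A := ring_structure E) a) (tp (A := ring_structure E) a') ->
  acl (fun z => exists j, z = a (c j)) (a i) ->
  acl (fun z => exists j, z = a' (c j)) (a' i).
Proof.
move=> aa' /aclP[ts h]; apply/aclP; exists ts.
have e (b : 'I_k -> E) :
    (fun j => b (scons i c j)) = scons (b i) (fun j => b (c j)).
  exact: scons_comp.
have [h' _] := aa' (rename (root_formula ts) (scons i c)).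
by move: h'; rewrite /tp !holds_rename !e; apply.
Qed.

(** An entry of [a'] that depends on the others would give, by equality of types,
    such an entry of [a], contradicting minimality.  So [a'] is independent and as
    long as the spanning tuple [a]: Steinitz exchange leaves nothing of [a]. *)
Lemma spans_of_type_minimal k (a a' : 'I_k -> E) : tuple_spans a ->
    (forall m (c : 'I_m -> E), (m < k)%N -> ~ tuple_spans c) ->
    eq_type (tp (A := ring_structure E) a) (tp (A := ring_structure E) a') ->
  tuple_spans a'.
Proof.
move=> spa mina aa'.
have entry_of_codom (b : 'I_k -> E) z : z \in codom b -> exists i, z = b i.
  by case/codomP=> i ->; exists i.
have indep i : ~ acl (fun z => exists2 j, j != i & z = a' j) (a' i).
  case: k a a' spa mina aa' {entry_of_codom} i => [|k] a a' spa mina aa' i.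
    by case: i.
  move=> dep; apply: (mina k (fun j => a (lift i j))) => // x.
  apply: acl_sub (spa x) => _ [j ->].
  have [->|ji] := eqVneq j i; last first.
    apply: acl_mem.
    by case: (unliftP i j) ji => [l ->|->]; [exists l|rewrite eqxx].
  apply: (dependence_of_type (a := a') (c := lift i)).
    by move=> phi; have [? ?] := aa' phi.
  apply: acl_mono dep => z [l li ->].
  by case: (unliftP i l) li => [l' ->|->]; [exists l'|rewrite eqxx].
have [|x|w' sz sp] := @spanning_exchange E (codom a') (codom a).
- move=> l1 x l2 e.
  have l1k : (size l1 < k)%N.
    by rewrite -[k]card_ord -(size_codom a') e size_cat /= addnS ltnS leq_addr.
  have nthE (n : 'I_k) : nth 0 (codom a') n = a' n.
    by rewrite (nth_map n) ?nth_ord_enum // size_enum_ord.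
  have xE : x = a' (Ordinal l1k) by rewrite -nthE e nth_cat ltnn subnn.
  move=> dep; apply: (indep (Ordinal l1k)); rewrite -xE.
  apply: acl_mono dep => z zl2.
  have lk : (size l1 + (index z l2).+1 < k)%N.
    rewrite -[k]card_ord -(size_codom a') e size_cat /= ltn_add2l ltnS.
    by rewrite index_mem.
  exists (Ordinal lk); first by rewrite -val_eqE /= -{2}[size l1]addn0 eqn_add2l.
  by rewrite -nthE e nth_cat /= ltnNge leq_addr /= addKn /= nth_index.
- by apply: acl_mono (spa x) => _ [i ->]; apply: codom_f.
move: sz; rewrite !size_codom => /eqP; rewrite -[X in _ == X]addn0 eqn_add2l.
move=> /nilP w'0 x; apply: acl_mono (sp x) => z.
by rewrite w'0 cats0 => /entry_of_codom.
Qed.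

End RingFormulas.

(** * Fields of finite transcendence degree *)

Theorem theorem2p1 (E : fieldType)
    (hE : finite_transcendence_degree (@prime_subfield E)) :
  defined_by_types (ring_structure E).
Proof.
move=> F [EF FE].
have [n [[a spa] minn]] : exists n, (exists a : 'I_n -> E, tuple_spans a) /\
    forall m (c : 'I_m -> E), (m < n)%N -> ~ tuple_spans c.
  have [n0 [a0 [_ alg]]] := hE.
  have ex : exists n, `[<exists a : 'I_n -> E, tuple_spans a>].
    exists n0; apply/asboolP; exists a0 => x.
    apply: algebraic_over_mono (alg x) => z; apply.
      exact: subfield_gen_subfield.
    move=> y [Py|ay]; last exact: mem_subfield_gen.
    by apply: Py => //; exact: subfield_gen_subfield.
  case: (ex_minnP ex) => n /asboolP spn min; exists n; split=> // m c mn spc.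
  have /min : `[<exists a : 'I_m -> E, tuple_spans a>] by apply/asboolP; exists c.
  by rewrite leqNgt mn.
have [b ab] := EF n a.
apply: (isomorphic_of_algebraic ab) => [x|y].
  exact: algebraic_over_tuple_of_acl.
(* [c] is the tuple [(e, a')] of the type of [(y, b)] *)
have [c bc] := FE _ (scons y b).
pose e := c ord0; pose a' i := c (lift ord0 i).
have cE : c = scons e a'.
  by apply/funext=> i; case: (unliftP ord0 i) => [j|] ->; rewrite ?sconsS ?scons0.
have bE : (fun i => scons y b (lift ord0 i)) = b by apply/funext=> i; rewrite sconsS.
have aa' : eq_type (tp (A := ring_structure E) a) (tp (A := ring_structure E) a').
  move=> phi; have := bc (rename phi (lift ord0)).
  by rewrite /tp !holds_rename bE => h; rewrite -[holds phi a']h; apply: ab.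
have [phi [pe [s ps]]] :=
  algebraic_over_tuple_of_acl (spans_of_type_minimal spa minn aa' e).
have amb : holds (A := F) (at_most (size s) phi) b.
  have /bc : holds (A := ring_structure E)
      (rename (at_most (size s) phi) (lift ord0)) c.
    by apply/holds_rename/holds_at_most; exists s.
  by move=> /holds_rename; rewrite bE.
exists phi; split; first by apply/bc; rewrite /tp cE.
by have /holds_at_most[s' _ ?] := amb; exists s'.
Qed.
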